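(* Let $$L=\sum_{i}a_i\,\varphi^*D^i+\sum_{j}b_j\,D^j\in\mathbb{R}[D,\varphi^*],$$ where $i,j$ range over the non-negative integers, $a_i,b_j\in\mathbb{R}$, and only finitely many of the coefficients are non-zero. Define $$R=\sum_{k}a_k\,\varphi^*D^k+\sum_{l}(-1)^{l+1}b_l\,D^l\in\mathbb{R}[D,\varphi^*].$$ Then $RL=LR$ and $RL\in\mathbb{R}[D]$.
   Context: $D$ is the differentiation operator and $\varphi^*$ is the pullback by the reflection $\varphi(t)=-t$, i.e. $(\varphi^*f)(t)=f(-t)$, for functions $f$ on $\mathbb{R}$. $\mathbb{R}[D,\varphi^*]$ denotes the real non-commutative algebra consisting of all finite real linear combinations of the generators $D^k$ and $\varphi^*D^k$, $k=0,1,2,\dots$ (with $D^0=\mathrm{Id}$), the product being composition of operators. Composition obeys $D^k\varphi^*=(-1)^k\varphi^*D^k$ for all $k\ge 0$ and $(\varphi^* )^2=\mathrm{Id}$, and real constants commute with everything. $\mathbb{R}[D]\subset\mathbb{R}[D,\varphi^*]$ is the subalgebra of polynomials in $D$ with real coefficients. *)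

(* Defs.v *)
From HB Require Import structures.
From mathcomp Require Import all_boot all_order all_algebra.
From mathcomp Require Import all_classical all_reals all_analysis.

Set Implicit Arguments.
Unset Strict Implicit.
Unset Printing Implicit Defensive.

Import Order.TTheory GRing.Theory Num.Theory.
Import numFieldNormedType.Exports.

Local Open Scope classical_set_scope.
Local Open Scope ring_scope.

Definition smooth (R : realType) : {pred R -> R} :=
  fun f => `[< forall (n : nat) (x : R), derivable (f^`(n))%classic x 1 >].
Arguments smooth : clear implicits.

Section SmoothTheory.
Variable R : realType.
Implicit Types f g : R -> R.

Lemma smoothP f :
  reflect (forall (n : nat) (x : R), derivable (f^`(n))%classic x 1)
          (f \in smooth R).
Proof. exact: asboolP. Qed.

Lemma derive1n_linear (c : R) f g n : f \in smooth R -> g \in smooth R ->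
  ((c *: f + g)^`(n))%classic = c *: (f^`(n))%classic + (g^`(n))%classic.
Proof.
move=> /smoothP sf /smoothP sg; elim: n => [//|n IHn].
rewrite !derive1nS IHn; apply/funext => x; rewrite derive1E.
by rewrite (deriveD (derivableZ (k := c) (sf n x)) (sg n x)) deriveZ // -!derive1E.
Qed.

Lemma derive1n_reflect f n : f \in smooth R ->
  ((f \o -%R)^`(n))%classic = (-1) ^+ n *: ((f^`(n))%classic \o -%R).
Proof.
move=> /smoothP sf; elim: n => [|n IHn]; first by rewrite expr0 scale1r.
rewrite !derive1nS IHn; apply/funext => x; rewrite derive1E.
have dc : derivable ((f^`(n))%classic \o -%R) x 1.
  apply/derivable1_diffP/differentiable_comp; apply/derivable1_diffP.
    exact: derivable_opp.
  exact: sf.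
rewrite (deriveZ _ dc) -derive1E derive1_comp; last exact: sf.
  2: exact: derivable_opp.
have -> : ((-%R : R -> R)^`())%classic x = -1.
  rewrite (_ : (-%R : R -> R) = - id) // derive1N; last exact: derivable_id.
  by rewrite derive1_id.
by rewrite mulrN1 exprS mulN1r scalerN -scaleNr.
Qed.

Fact smooth_submod_closed : submod_closed (smooth R).
Proof.
split=> [|c f g sf sg]; apply/smoothP => n x.
  elim: n x => [|n IHn] x; first exact: derivable_cst.
  suff -> : ((0 : R -> R)^`(n.+1))%classic = (0^`(n))%classic by exact: IHn.
  rewrite derive1Sn; congr (_^`(n))%classic; apply/funext => y.
  exact: (derive1_cst (0 : R)).
rewrite (derive1n_linear _ _ sf sg).
move: sf sg => /smoothP/(_ n x) df /smoothP/(_ n x) dg.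
exact: (derivableD (derivableZ (k := c) df) dg).
Qed.

HB.instance Definition _ :=
  GRing.isSubmodClosed.Build R (R -> R) (smooth R) smooth_submod_closed.

Lemma smooth_derive f : f \in smooth R -> (f^`())%classic \in smooth R.
Proof. by move=> /smoothP sf; apply/smoothP => n; rewrite -derive1Sn. Qed.

Lemma smooth_reflect f : f \in smooth R -> f \o -%R \in smooth R.
Proof.
move=> sf; apply/smoothP => n x; rewrite derive1n_reflect //.
apply: derivableZ; apply/derivable1_diffP/differentiable_comp.
  by apply/derivable1_diffP; exact: derivable_opp.
by apply/derivable1_diffP; exact/smoothP.
Qed.

End SmoothTheory.

Record smoothfun (R : realType) := SmoothFun {
  smoothfun_val :> R -> R;
  _ : smoothfun_val \in smooth R
}.

HB.instance Definition _ (R : realType) :=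
  [isSub for @smoothfun_val R].
HB.instance Definition _ (R : realType) :=
  [Choice of smoothfun R by <:].
HB.instance Definition _ (R : realType) :=
  [SubChoice_isSubZmodule of smoothfun R by <:].
HB.instance Definition _ (R : realType) :=
  [SubZmodule_isSubLmodule of smoothfun R by <:].

(* {linear V -> V}, under a name of its own so that it can carry the ring
   structure whose product is composition. *)
Definition linop (R : comNzRingType) (V : lmodType R) := {linear V -> V}.

Section LinopAlgebra.
Variables (R : comNzRingType) (V : lmodType R).
Local Notation E := (linop V).

HB.instance Definition _ := gen_eqMixin E.
HB.instance Definition _ := gen_choiceMixin E.

Lemma linopP (S T : E) : (S : V -> V) =1 T -> S = T.
Proof.
move=> eqST; have {}eqST : (S : V -> V) = T by apply/funext.
case: S T eqST => [S cS] [T cT] /= eqST; case: _ / eqST cT => cT.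
case: cS cT => [[aS] [sS]] [[aT] [sT]].
by rewrite (Prop_irrelevance aS aT) (Prop_irrelevance sS sT).
Qed.


Implicit Types S T U : E.

Definition linop0 : E := [the {linear V -> V} of \0].
Definition linop_opp S : E := [the {linear V -> V} of \- S].
Definition linop_add S T : E := [the {linear V -> V} of S \+ T].
Definition linop_scale c S : E := [the {linear V -> V} of c \*: S].
Definition linop1 : E := [the {linear V -> V} of idfun].
Definition linop_comp S T : E := [the {linear V -> V} of S \o T].

Fact linop_addA : associative linop_add.
Proof. by move=> S T U; apply: linopP => v; exact: addrA. Qed.
Fact linop_addC : commutative linop_add.
Proof. by move=> S T; apply: linopP => v; exact: addrC. Qed.
Fact linop_add0 : left_id linop0 linop_add.
Proof. by move=> S; apply: linopP => v; exact: add0r. Qed.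
Fact linop_addN : left_inverse linop0 linop_opp linop_add.
Proof. by move=> S; apply: linopP => v; exact: addNr. Qed.
HB.instance Definition _ :=
  GRing.isZmodule.Build E linop_addA linop_addC linop_add0 linop_addN.

Fact linop_compA : associative linop_comp.
Proof. by move=> S T U; apply: linopP. Qed.
Fact linop_comp1 : left_id linop1 linop_comp.
Proof. by move=> S; apply: linopP. Qed.
Fact linop_compr1 : right_id linop1 linop_comp.
Proof. by move=> S; apply: linopP. Qed.
Fact linop_compDl : left_distributive linop_comp +%R.
Proof. by move=> S T U; apply: linopP. Qed.
Fact linop_compDr : right_distributive linop_comp +%R.
Proof. by move=> S T U; apply: linopP => v; exact: raddfD. Qed.
HB.instance Definition _ := GRing.Zmodule_isPzRing.Build E
  linop_compA linop_comp1 linop_compr1 linop_compDl linop_compDr.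

Fact linop_scaleA a b S :
  linop_scale a (linop_scale b S) = linop_scale (a * b) S.
Proof. by apply: linopP => v; exact: scalerA. Qed.
Fact linop_scale1 : left_id 1 linop_scale.
Proof. by move=> S; apply: linopP => v; exact: scale1r. Qed.
Fact linop_scaleDr : right_distributive linop_scale +%R.
Proof. by move=> a S T; apply: linopP => v; exact: scalerDr. Qed.
Fact linop_scaleDl S : {morph linop_scale^~ S : a b / a + b}.
Proof. by move=> a b; apply: linopP => v; exact: scalerDl. Qed.
HB.instance Definition _ := GRing.Zmodule_isLmodule.Build R E
  linop_scaleA linop_scale1 linop_scaleDr linop_scaleDl.

Fact linop_scaleAl a S T : a *: (S * T) = a *: S * T.
Proof. exact: linopP. Qed.
Fact linop_scaleAr a S T : a *: (S * T) = S * (a *: T).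
Proof. by apply: linopP => v; rewrite /= [RHS]linearZ. Qed.
Lemma linopM S T v : (S * T) v = S (T v). Proof. by []. Qed.

End LinopAlgebra.

Section DiffReflOperators.
Variable R : realType.
Implicit Types f : smoothfun R.

Fact smooth_cst1 : cst 1 \in smooth R.
Proof.
apply/smoothP => n x; case: n => [|n]; first exact: derivable_cst.
suff -> : ((cst 1 : R -> R)^`(n.+1))%classic = 0.
  have /smoothP s0 : (0 : R -> R) \in smooth R by exact: rpred0.
  exact: (s0 0).
elim: n => [|n IHn]; apply/funext => y; last rewrite derive1nS IHn.
  exact: derive1_cst.
exact: (derive1_cst (0 : R)).
Qed.

Fact linop_smooth_neq0 : 1 != 0 :> linop (smoothfun R).
Proof.
apply/eqP => /(congr1 (fun T : linop (smoothfun R) =>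
  T (SmoothFun smooth_cst1) 0)) /eqP.
by rewrite oner_eq0.
Qed.

HB.instance Definition _ :=
  GRing.PzSemiRing_isNonZero.Build (linop (smoothfun R)) linop_smooth_neq0.
HB.instance Definition _ := GRing.LSemiModule_isLSemiAlgebra.Build R
  (linop (smoothfun R)) (@linop_scaleAl R (smoothfun R)).
HB.instance Definition _ := GRing.LSemiAlgebra_isSemiAlgebra.Build R
  (linop (smoothfun R)) (@linop_scaleAr R (smoothfun R)).

Definition sderive f : smoothfun R := SmoothFun (smooth_derive (valP f)).
Definition sreflect f : smoothfun R := SmoothFun (smooth_reflect (valP f)).

Fact sderive_is_linear : linear sderive.
Proof.
move=> c f g; apply: val_inj; rewrite /= -derive1n1.
by rewrite derive1n_linear ?(valP f) ?(valP g).
Qed.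
HB.instance Definition _ := GRing.isLinear.Build R _ _ _ sderive
  sderive_is_linear.

Fact sreflect_is_linear : linear sreflect.
Proof. by move=> c f g; exact: val_inj. Qed.
HB.instance Definition _ := GRing.isLinear.Build R _ _ _ sreflect
  sreflect_is_linear.

Definition opD : linop (smoothfun R) := [the {linear _ -> _} of sderive].
Definition opphi : linop (smoothfun R) := [the {linear _ -> _} of sreflect].

Lemma opphiK : opphi * opphi = 1.
Proof.
apply: linopP => f; apply: val_inj; apply/funext => x /=.
by rewrite opprK.
Qed.

Lemma opDphi : opD * opphi = - (opphi * opD).
Proof.
apply: linopP => f; apply: val_inj; rewrite /= -derive1n1.
by rewrite derive1n_reflect ?(valP f) // expr1 scaleN1r.
Qed.

Lemma opDXphi k : opD ^+ k * opphi = (-1) ^+ k *: (opphi * opD ^+ k).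
Proof.
elim: k => [|k IHk]; first by rewrite !expr0 scale1r mul1r mulr1.
rewrite exprS -mulrA IHk -scalerAr mulrA opDphi mulNr -mulrA -exprS.
by rewrite [in RHS](exprS (-1)) mulN1r scalerN scaleNr.
Qed.

Definition diffrefl_span : {pred linop (smoothfun R)} := fun T =>
  `[< exists n (a b : nat -> R), T =
      \sum_(k < n) a k *: (opphi * opD ^+ k) + \sum_(k < n) b k *: opD ^+ k >].

Lemma horner_opDE (p : {poly R}) n : (size p <= n)%N ->
  horner_alg opD p = \sum_(k < n) p`_k *: opD ^+ k.
Proof.
move=> ltpn; rewrite /horner_alg /horner_morph (horner_coef_wide _ (n := n)).
  by apply: eq_bigr => k _; rewrite coef_map /= -scalerAl mul1r.
exact: leq_trans (size_poly _ _) ltpn.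
Qed.

Lemma diffrefl_spanP T :
  reflect (exists p q : {poly R},
             T = opphi * horner_alg opD p + horner_alg opD q)
          (T \in diffrefl_span).
Proof.
apply: (iffP (asboolP _)) => [[n [a [b ->]]]|[p [q ->]]].
  exists (\poly_(k < n) a k), (\poly_(k < n) b k).
  rewrite !(@horner_opDE _ n) ?size_poly // mulr_sumr.
  by congr (_ + _); apply: eq_bigr => k _;
    rewrite coef_poly ltn_ord // -scalerAr.
exists (maxn (size p) (size q)), (nth 0 p), (nth 0 q).
rewrite -(horner_opDE (leq_maxr _ _)) (horner_opDE (leq_maxl _ (size q))).
by rewrite mulr_sumr; congr (_ + _); apply: eq_bigr => k _; rewrite -scalerAr.
Qed.

Lemma horner_opD_phi (p : {poly R}) :
  horner_alg opD p * opphi = opphi * horner_alg opD (p \Po (- 'X)).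
Proof.
elim/poly_ind: p => [|p c IHp]; first by rewrite comp_poly0 !rmorph0 mul0r mulr0.
rewrite comp_polyD comp_polyM comp_polyX comp_polyC !rmorphD !rmorphM /=.
rewrite rmorphN /= !horner_algC !horner_algX mulrDl mulrDr.
congr (_ + _); last by rewrite -scalerAl -scalerAr mul1r mulr1.
by rewrite -mulrA opDphi mulrN mulrA IHp -mulrA -!mulrN.
Qed.

Fact diffrefl_subalg_closed : subalg_closed diffrefl_span.
Proof.
split.
- by apply/diffrefl_spanP; exists 0, 1; rewrite rmorph0 rmorph1 mulr0 add0r.
- move=> c S T /diffrefl_spanP[p [q ->]] /diffrefl_spanP[p' [q' ->]].
  apply/diffrefl_spanP; exists (c *: p + p'), (c *: q + q').
  rewrite !linearP /= -!scalerAl !mul1r.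
  by rewrite mulrDr scalerDr -scalerAr addrACA.
- move=> S T /diffrefl_spanP[p [q ->]] /diffrefl_spanP[p' [q' ->]].
  apply/diffrefl_spanP.
  exists (p * q' + (q \Po - 'X) * p'), ((p \Po - 'X) * p' + q * q').
  rewrite !rmorphD !rmorphM /= mulrDl !mulrDr.
  rewrite [_ * (opphi * _)]mulrA -[opphi * _ * opphi]mulrA horner_opD_phi.
  rewrite [opphi * (opphi * _)]mulrA opphiK mul1r.
  rewrite [horner_alg opD q * (opphi * _)]mulrA horner_opD_phi !mulrA.
  by rewrite [X in X + _ = _]addrC addrACA.
Qed.

HB.instance Definition _ := GRing.isSubalgClosed.Build R
  (linop (smoothfun R)) diffrefl_span diffrefl_subalg_closed.

End DiffReflOperators.

Arguments diffrefl_span : clear implicits.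

(* R[D, phi^*]: the elements are genuine operators on C^infinity(R), which is
   the domain on which all the D^k and phi^* act and can be composed. *)
Record diffrefl (R : realType) := DiffRefl {
  diffrefl_val :> linop (smoothfun R);
  _ : diffrefl_val \in diffrefl_span R
}.

HB.instance Definition _ (R : realType) := [isSub for @diffrefl_val R].
HB.instance Definition _ (R : realType) := [Choice of diffrefl R by <:].
HB.instance Definition _ (R : realType) :=
  [SubChoice_isSubNzRing of diffrefl R by <:].
HB.instance Definition _ (R : realType) :=
  [SubZmodule_isSubLmodule of diffrefl R by <:].
HB.instance Definition _ (R : realType) :=
  [SubNzRing_SubLmodule_isSubLalgebra of diffrefl R by <:].
HB.instance Definition _ (R : realType) :=
  [SubLalgebra_isSubAlgebra of diffrefl R by <:].

Section DiffRefl.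
Variable R : realType.

Fact opD_diffrefl : opD R \in diffrefl_span R.
Proof.
by apply/diffrefl_spanP; exists 0, 'X; rewrite rmorph0 mulr0 add0r horner_algX.
Qed.
Fact opphi_diffrefl : opphi R \in diffrefl_span R.
Proof.
by apply/diffrefl_spanP; exists 1, 0; rewrite rmorph0 rmorph1 mulr1 addr0.
Qed.

Definition diffop : diffrefl R := DiffRefl opD_diffrefl.
Definition reflphi : diffrefl R := DiffRefl opphi_diffrefl.

(* R[D], as a subset of R[D, phi^*]: the operators p(D), p a polynomial. *)
Definition polyD : set (diffrefl R) := range (horner_alg diffop).

Lemma reflphiK : reflphi * reflphi = 1.
Proof. by apply: val_inj; exact: opphiK. Qed.

Lemma diffopXphi k : diffop ^+ k * reflphi = (-1) ^+ k *: (reflphi * diffop ^+ k).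
Proof.
by apply: val_inj; rewrite linearZ !rmorphM !rmorphXn /=; exact: opDXphi.
Qed.

End DiffRefl.
Arguments polyD : clear implicits.

(* Main.v *)
Require Import Defs.
From mathcomp Require Import all_boot all_order all_algebra.
From mathcomp Require Import all_classical all_reals all_analysis.

Set Implicit Arguments.
Unset Strict Implicit.
Unset Printing Implicit Defensive.

Import GRing.Theory Num.Theory.
Import numFieldNormedType.Exports.

Local Open Scope classical_set_scope.
Local Open Scope ring_scope.

(** Collect the coefficients into polynomials [p] and [q], so that
    [L = phi p(D) + q(D)]. Since [(-1)^(l+1) D^l = - (-D)^l], the second
    operator is [Rop = phi p(D) - q(-D)]. The relation [D phi = - phi D] says
    that [phi] passes across [f(D)] by turning it into [f(-D)]
    ([horner_alg_anticomm]). In the expansion of [Rop L] the two terms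
    carrying [phi] are therefore [phi p(D) q(D)] and [- q(-D) phi p(D)
    = - phi q(D) p(D)]; they cancel because polynomials in [D] commute. As
    [phi^2 = 1], the two remaining terms give
      [Rop L = p(-D) p(D) - q(-D) q(D)],
    a polynomial in [D]. The terms of [L Rop] behave in the same way and leave
    the same polynomial. This uses only the two relations between [D] and
    [phi], so it is carried out in an arbitrary algebra. *)

(** Turning a finitely supported family into a polynomial lets the
    commutativity of the polynomial ring replace rearrangements of double
    sums. *)
Lemma finite_support_poly (R : nzRingType) (a : nat -> R) :
  finite_set [set i | a i != 0] -> exists p : {poly R}, a = nth 0 p.
Proof.
move=> /finite_seqP[s supp_a].
exists (\poly_(i < (\max_(j <- s) j).+1) a i); apply/funext => i.
rewrite coef_poly ltnS; case: ifPn => //; apply: contraNeq => a_i.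
have i_s : i \in s by have : [set i | a i != 0] i by []; rewrite supp_a.
exact: (leq_bigmax_seq (F := id)).
Qed.

Section AnticommutingInvolution.
Variables (R : comNzRingType) (A : algType R).
Implicit Types (x y : A) (p q : {poly R}).

(** The left factor [y] is what allows one lemma to serve the [phi] part of the
    operators as well as their differential parts, where [y] is [1] or [-1]. *)
Lemma fsum_mul_horner_alg y x p :
  \sum_(i \in [set: nat]) p`_i *: (y * x ^+ i) = y * horner_alg x p.
Proof.
rewrite -(@fsbig_widen _ _ _ _ `I_(size p)) //; last first.
  move=> i [_ /= /negP]; rewrite -leqNgt => le_pi.
  by rewrite nth_default // scale0r.
rewrite -fsbig_ord /horner_alg /horner_morph.
rewrite (horner_coef_wide _ (n := size p)) ?size_poly // mulr_sumr.
by apply: eq_bigr => i _; rewrite coef_map /= mulr_algl -scalerAr.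
Qed.

Lemma horner_algN x p : horner_alg (- x) p = horner_alg x (p \Po - 'X).
Proof.
elim/poly_ind: p => [|p c IHp]; first by rewrite comp_poly0 !rmorph0.
rewrite comp_polyD comp_polyM comp_polyX comp_polyC !rmorphD !rmorphM /=.
by rewrite rmorphN /= !horner_algC !horner_algX IHp.
Qed.

Lemma horner_alg_anticomm x y p : x * y = - (y * x) ->
  horner_alg x p * y = y * horner_alg (- x) p.
Proof.
move=> xy; elim/poly_ind: p => [|p c IHp].
  by rewrite !rmorph0 mul0r mulr0.
rewrite !rmorphD !rmorphM /= !horner_algC !horner_algX mulrDl mulrDr.
by rewrite mulr_algl mulr_algr -mulrA xy mulrN mulrA IHp -mulrA -!mulrN.
Qed.

Variables (x y : A).
Hypotheses (yy : y * y = 1) (xy : x * y = - (y * x)).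

(** Moving [y] to the left past both kinds of polynomials kills the two mixed
    terms. Conjugation by [y] exchanges [x] and [- x], so [horner_alg_anticomm]
    applies to [- x] as well. *)
Lemma reflected_factor_mul p q :
  (y * horner_alg x p - horner_alg (- x) q)
      * (y * horner_alg x p + horner_alg x q)
    = horner_alg x ((p \Po - 'X) * p - (q \Po - 'X) * q).
Proof.
have Nxy : - x * y = - (y * - x) by rewrite mulNr mulrN xy.
rewrite mulrBl !mulrDr [horner_alg (- x) q * (y * _)]mulrA.
rewrite (horner_alg_anticomm _ Nxy) opprK.
rewrite [y * _ * (y * _)]mulrA -[y * _ * y]mulrA (horner_alg_anticomm _ xy).
rewrite !mulrA yy mul1r -!mulrA -!rmorphM /= [q * p]mulrC opprD addrA addrK.
by rewrite !horner_algN -!rmorphM -rmorphB.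
Qed.

Lemma reflected_factor_comm p q :
  (y * horner_alg x p - horner_alg (- x) q)
      * (y * horner_alg x p + horner_alg x q)
    = (y * horner_alg x p + horner_alg x q)
      * (y * horner_alg x p - horner_alg (- x) q).
Proof.
rewrite reflected_factor_mul mulrDl !mulrBr [horner_alg x q * (y * _)]mulrA.
rewrite (horner_alg_anticomm _ xy).
rewrite [y * _ * (y * _)]mulrA -[y * _ * y]mulrA (horner_alg_anticomm _ xy).
rewrite !mulrA yy mul1r -!mulrA !horner_algN -!rmorphM /= [p * _]mulrC.
by rewrite [q * _]mulrC addrA subrK rmorphB.
Qed.

End AnticommutingInvolution.

Theorem theorem2p1 (R : realType) (a b : nat -> R)
    (a_fin : finite_set [set i | a i != 0])
    (b_fin : finite_set [set j | b j != 0]) :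
  let D := diffop R in
  let phi := reflphi R in
  let L : diffrefl R :=
    \sum_(i \in [set: nat]) a i *: (phi * D ^+ i)
      + \sum_(j \in [set: nat]) b j *: D ^+ j in
  let Rop : diffrefl R :=
    \sum_(k \in [set: nat]) a k *: (phi * D ^+ k)
      + \sum_(l \in [set: nat]) ((-1) ^+ l.+1 * b l) *: D ^+ l in
  Rop * L = L * Rop /\ polyD R (Rop * L).
Proof.
move=> D phi L Rop.
have [p def_a] := finite_support_poly a_fin.
have [q def_b] := finite_support_poly b_fin.
have Dphi : D * phi = - (phi * D).
  by have := diffopXphi R 1; rewrite !expr1 scaleN1r.
have defL : L = phi * horner_alg D p + horner_alg D q.
  rewrite /L def_a def_b fsum_mul_horner_alg -[horner_alg D q]mul1r.
  rewrite -(fsum_mul_horner_alg 1); congr (_ + _).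
  by apply: eq_fsbigr => j _; rewrite mul1r.
have defR : Rop = phi * horner_alg D p - horner_alg (- D) q.
  rewrite /Rop def_a def_b fsum_mul_horner_alg -[- horner_alg _ q]mulN1r.
  rewrite -(fsum_mul_horner_alg (-1)); congr (_ + _); apply: eq_fsbigr => l _.
  rewrite [(- D) ^+ l]exprNn mulrA -exprS mulrC -scalerA; congr (_ *: _).
  by rewrite -[in LHS]signr_odd scaler_sign -[in RHS]signr_odd mulr_sign.
rewrite defL defR; split.
  exact: reflected_factor_comm (reflphiK R) Dphi p q.
rewrite (reflected_factor_mul (reflphiK R) Dphi).
by exists ((p \Po - 'X) * p - (q \Po - 'X) * q).
Qed.
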